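(* Let $l\in\mathbb{Z}_{\ge0}$, let $P$ be a polynomial in $d$ variables with coefficients in $\mathbb{C}$, and let $x_0\in\mathbb{C}^d$ be a root of $P$. Let $\alpha\in\mathbb{Z}_{\ge0}^d$ be such that $D^\alpha P(x_0)$ is a non-zero derivative of $P$ at $x_0$ of the least order (that is, $D^\alpha P(x_0)\neq0$ and $D^{\alpha'}P(x_0)=0$ for all $\alpha'$ with $|\alpha'|<|\alpha|$). Then $$\dim\left(e^{ix_0\cdot x}\Pi_{\le l}\cap\ker P(-iD)\right)=\begin{cases}\tilde d(l)-\tilde d(l-|\alpha|)&\text{if } l\ge|\alpha|>0,\\ \tilde d(l)&\text{if } l<|\alpha|.\end{cases}$$ Moreover, if $l<|\alpha|$, then $e^{ix_0\cdot x}\Pi_{\le l}\cap\ker P(-iD)=e^{ix_0\cdot x}\Pi_{\le l}$.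
   Context: Here $d\in\mathbb{N}$, $|\alpha|=\alpha_1+\dots+\alpha_d$, $x\cdot y=x_1y_1+\cdots+x_dy_d$, and $D^\alpha=D_1^{\alpha_1}\cdots D_d^{\alpha_d}$ with $D_n$ the partial derivative in the $n$th coordinate. $\Pi_{\le l}$ is the complex linear span of the monomials $x^\alpha$ in $d$ variables with $|\alpha|\le l$, and $e^{ix_0\cdot x}\Pi_{\le l}$ is the space of functions $e^{ix_0\cdot x}p(x)$, $p\in\Pi_{\le l}$. $\tilde d(k)=\frac{(d+k)!}{k!\,d!}$ for $k\in\mathbb{Z}_{\ge0}$. $P(-iD)$ is the constant coefficient differential operator obtained by substituting $-iD_n$ for the $n$th variable of $P$; $\ker P(-iD)$ is its null-space. Dimensions are over $\mathbb{C}$. *)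

(* Defs.v *)
(* The field of complex numbers is [R[i]], for [R] a [realType]. *)
From HB Require Import structures.
From mathcomp Require Import all_boot all_order all_algebra.
From mathcomp Require Import all_classical all_reals all_analysis.
From mathcomp Require Export complex.
(* The notations of mpoly clash with those of the analysis library; the few
   that are needed are redeclared below. *)
From mathcomp Require Export -(notations) mpoly.

Set Implicit Arguments.
Unset Strict Implicit.
Unset Printing Implicit Defensive.

Import Order.TTheory GRing.Theory Num.Theory.
Import numFieldNormedType.Exports.

Local Open Scope classical_set_scope.
Local Open Scope ring_scope.

Notation "{ 'mpoly' T [ n ] }" := (mpoly n T)
  (at level 0, T at level 2, n at level 2, format "{ 'mpoly'  T [ n ] }")
  : type_scope.
Notation "p @_ i" := (mcoeff i p) (at level 1, i at level 2) : ring_scope.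
Notation "p ^`M [ m ]" := (mderivm m p)
  (at level 1, format "p ^`M [ m ]") : ring_scope.
Notation "p .@[ v ]" := (meval v p)
  (at level 1, format "p .@[ v ]") : ring_scope.

Section Definitions.
Variable R : realType.
Implicit Types (d l k n : nat).

(* [e^(a + ib) = e^a (cos b + i sin b)] *)
Definition cexp (z : R[i]) : R[i] :=
  ((expR (complex.Re z) * cos (complex.Im z)) +i*
   (expR (complex.Re z) * sin (complex.Im z)))%C.

(* The canonical embedding of [R^d] in [C^d]. *)
Definition cvec d (x : 'rV[R]_d) : 'I_d -> R[i] := fun j => (x ord0 j)%:C%C.

Definition cdot d (x0 : 'rV[R[i]]_d) (x : 'rV[R]_d) : R[i] :=
  \sum_(j < d) x0 ord0 j * cvec x j.

(* The library has no derivative of [R[i]]-valued functions of real variables: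
   the real and imaginary parts are differentiated separately.  Like ['D_v f],
   [pderiv j f] is only meaningful where the derivatives exist, see [smooth]. *)
Definition pderiv d (j : 'I_d) (f : 'rV[R]_d -> R[i]) : 'rV[R]_d -> R[i] :=
  fun x => ('D_('e_j) (fun y => complex.Re (f y)) x +i*
            'D_('e_j) (fun y => complex.Im (f y)) x)%C.

Definition iter_pderiv d (s : seq 'I_d) (f : 'rV[R]_d -> R[i]) :=
  foldr (@pderiv d) f s.

(* [C^infty(R^d)]: all iterated partial derivatives exist and are continuous. *)
Definition smooth d : set ('rV[R]_d -> R[i]) :=
  [set f | forall s : seq 'I_d,
    [/\ continuous (fun x => complex.Re (iter_pderiv s f x)),
        continuous (fun x => complex.Im (iter_pderiv s f x)) &
        forall (j : 'I_d) (x : 'rV[R]_d),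
          derivable (fun y => complex.Re (iter_pderiv s f y)) x 'e_j /\
          derivable (fun y => complex.Im (iter_pderiv s f y)) x 'e_j]].

Definition miD d (j : 'I_d) (f : 'rV[R]_d -> R[i]) : 'rV[R]_d -> R[i] :=
  fun x => - 'i%C * pderiv j f x.

(* [(-iD_1)^(m_1) ... (-iD_d)^(m_d) f] *)
Definition miDm d (m : multinom d) (f : 'rV[R]_d -> R[i]) : 'rV[R]_d -> R[i] :=
  foldr (fun j g => iter (m j) (miD j) g) f (enum 'I_d).

(* [P(-iD)] *)
Definition diffop d (P : {mpoly R[i][d]}) (f : 'rV[R]_d -> R[i]) :
    'rV[R]_d -> R[i] :=
  fun x => \sum_(m <- msupp P) P@_m * miDm m f x.

Definition ker_diffop d (P : {mpoly R[i][d]}) : set ('rV[R]_d -> R[i]) :=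
  [set f | smooth f /\ forall x, diffop P f x = 0].

(* [e^(i x0 . x) Pi_(<= l)] *)
Definition exp_poly d (x0 : 'rV[R[i]]_d) l : set ('rV[R]_d -> R[i]) :=
  [set f | exists2 p : {mpoly R[i][d]},
     forall m, m \in msupp p -> (mdeg m <= l)%N &
     f = fun x => cexp ('i%C * cdot x0 x) * p.@[cvec x]].

End Definitions.

(* [E] is a linear subspace of dimension [n]: it is the set of linear
   combinations of [n] linearly independent vectors. *)
Definition has_dim (K : fieldType) (V : lmodType K) (E : set V) (n : nat) :=
  exists b : 'I_n -> V,
    (forall c : 'I_n -> K,
       \sum_(i < n) c i *: b i = 0 -> forall i, c i = 0) /\
    E = [set v | exists c : 'I_n -> K, v = \sum_(i < n) c i *: b i].

(* The division is exact. *)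
Definition dtilde (d k : nat) : nat := ((d + k)`! %/ (k`! * d`!))%N.

(* Main.v *)
Require Import Defs.
From mathcomp Require Import all_boot all_order all_algebra.
From mathcomp Require Import all_classical all_reals all_analysis.
From mathcomp Require Import -(notations) ssrcomplements.
From mathcomp Require Import ring.

(** Put m = |alpha| and let Q be P translated to x0, i.e. Q(y) = P(x0 + y).
    Multiplication by the exponential conjugates -iD_j into x0_j - iD_j, so

      P(-iD) (e^(i x0.x) p) = e^(i x0.x) (Q(-iD) p)

    ([diffop_expmul]).  As the exponential has no zero, and as a polynomial
    that vanishes on R^d is zero ([expmul_inj]), the question is the dimension
    of the kernel of Q(-iD) on the polynomials of degree at most l.

    By Taylor's formula ([mcoeff_translate]) the hypotheses on alpha say that
    Q has a term of degree m and none of smaller degree.  Hence Q(-iD) lowers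
    degrees by at least m: it maps the polynomials of degree <= l to those of
    degree <= l - m, and it is zero on them when l < m ([mcoeff_evalD_ge]).

    This map is onto ([row_full_evalD_mx]), and rank-nullity gives the dimension.
    To see that it is onto, look at its transpose: up to nonzero factors on
    the rows and the columns, that is multiplication by Q(-iy), followed by
    truncation of the terms of degree > l.  The lowest term of a product is
    the product of the lowest terms, for any monomial order that refines the
    degree; the lowest term of Q has degree m, so the product with Q of a
    nonzero polynomial of degree <= l - m has a term of degree <= l, and the
    transpose is injective.

    The number of monomials of degree <= k is found by homogenization
    ([card_bmultinom]). *)

Set Implicit Arguments.
Unset Strict Implicit.
Unset Printing Implicit Defensive.

Import Order.TTheory GRing.Theory Num.Theory.
Import numFieldNormedType.Exports.

Local Open Scope classical_set_scope.
Local Open Scope ring_scope.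

(** * Polynomials translated to a point *)

(** Identities and closure properties that are compatible with sums and
    products thus need a computation for constants and variables only. *)
Lemma mpoly_ring_ind n (K : comNzRingType) (S : {mpoly K[n]} -> Prop) :
  (forall c, S (mpolyC n c)) -> (forall i, S (mpolyX K (mnm1 i))) ->
  (forall p q, S p -> S q -> S (p + q)) ->
  (forall p q, S p -> S q -> S (p * q)) -> forall p, S p.
Proof.
move=> SC SX SD SM; elim/mpolyind => [|c m p _ _ Sp]; first by rewrite -mpolyC0.
apply: SD => //; rewrite -mul_mpolyC; apply: (SM) => //.
have S1 : S 1 by rewrite -(mpolyC1 n K); apply: SC.
rewrite mpolyXE_id; apply: (big_ind S S1 SM) => i _.
by elim: (m i) => [|k IH]; [rewrite expr0|rewrite exprS; apply: (SM)].
Qed.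

Lemma mcoeff0E n (K : comNzRingType) (p : {mpoly K[n]}) :
  p@_(@mnm0 n) = p.@[fun=> 0].
Proof.
elim/mpoly_ring_ind: p => [c|i|p q Hp Hq|p q Hp Hq].
- by rewrite mcoeffC eqxx mulr1 mevalC.
- rewrite mevalXU mcoeffX; case: eqP => // /(congr1 (@mdeg _)).
  by rewrite mdeg1 mdeg0.
- by rewrite mcoeffD mevalD Hp Hq.
- by rewrite mevalM -Hp -Hq; apply: (rmorphM (mcoeff (@mnm0 n))).
Qed.

Lemma mderiv_var n (K : comNzRingType) (i j : 'I_n) :
  mderiv j (mpolyX K (mnm1 i)) = mpolyC n (i == j)%:R.
Proof.
rewrite mderivX mnm1E; case: eqP => [->|_]; last by rewrite scale0r mpolyC0.
have -> : mnm_sub (mnm1 j) (mnm1 j) = @mnm0 n.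
  by apply/mnmP => k; rewrite mnmBE subnn mnm0E.
by rewrite mpolyX0 scale1r mpolyC1.
Qed.

Section Translation.
Variables (n : nat) (K : comNzRingType) (a : 'I_n -> K).

Definition translate (p : {mpoly K[n]}) : {mpoly K[n]} :=
  comp_mpoly [tuple mpolyX K (mnm1 i) + mpolyC n (a i) | i < n] p.

Lemma translateM p q : translate (p * q) = translate p * translate q.
Proof. by rewrite /translate rmorphM. Qed.

Lemma translateXU i : translate (mpolyX K (mnm1 i)) = mpolyX K (mnm1 i) + mpolyC n (a i).
Proof. by rewrite /translate comp_mpolyXU -tnth_nth tnth_mktuple. Qed.

Lemma mderiv_translate i p : mderiv i (translate p) = translate (mderiv i p).
Proof.
elim/mpoly_ring_ind: p => [c|j|p q Hp Hq|p q Hp Hq].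
- by rewrite /translate comp_mpolyC mderivC comp_mpoly0.
- by rewrite translateXU mderivD mderivC addr0 mderiv_var /translate comp_mpolyC.
- by rewrite /translate comp_mpolyD !mderivD comp_mpolyD; congr (_ + _).
- rewrite translateM !mderivM Hp Hq.
  by rewrite -!translateM /translate -comp_mpolyD.
Qed.

Lemma mderivm_translate m p : (translate p)^`M[m] = translate p^`M[m].
Proof.
rewrite !mderivm_foldr; elim: (flatten _) => //= i s ->.
exact: mderiv_translate.
Qed.

Lemma meval0_translate p : (translate p).@[fun=> 0] = p.@[a].
Proof.
rewrite comp_mpoly_meval; apply: meval_eq => i.
by rewrite tnth_mktuple mevalD mevalXU mevalC add0r.
Qed.

(** Taylor's formula: translation commutes with derivation, and the derivative
    of order m at the origin is m! times the coefficient of index m. *)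
Lemma mcoeff_translate p m :
  (translate p)@_m *+ (\prod_(i < n) (m i)`!) = p^`M[m].@[a].
Proof.
rewrite -meval0_translate -mderivm_translate -mcoeff0E mcoeff_mderivm addm0.
by congr (_ *+ _); apply: eq_bigr => i _; rewrite ffactnn.
Qed.

End Translation.

(** * Differential operators on polynomials *)

Section Operator.
Variables (n : nat) (K : comNzRingType) (u : K).
Implicit Types (p Q : {mpoly K[n]}).

(** [evalD Q p] is Q(uD) p; the case of interest is u = -i. *)
Definition evalD Q p : {mpoly K[n]} :=
  \sum_(m <- msupp Q) (Q@_m * u ^+ mdeg m) *: p^`M[m].

Lemma evalD_wE k Q p : (msize Q <= k)%N ->
  evalD Q p = \sum_(m : bmultinom n k) (Q@_m * u ^+ mdeg m) *: p^`M[m].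
Proof.
move=> Qk; rewrite /evalD (big_mksub (bmultinom n k)) /=.
- by rewrite big_rmcond //= => i /memN_msupp_eq0 ->; rewrite mul0r scale0r.
- exact: msupp_uniq.
- by move=> x /msize_mdeg_lt /leq_trans; apply.
Qed.

Lemma evalD_add Q Q' p : evalD (Q + Q') p = evalD Q p + evalD Q' p.
Proof.
pose k := maxn (msize (Q + Q')) (maxn (msize Q) (msize Q')).
rewrite !(@evalD_wE k) ?leq_max ?leqnn ?orbT // -big_split /=.
by apply: eq_bigr => m _; rewrite mcoeffD mulrDl scalerDl.
Qed.

Lemma evalD_scale c Q p : evalD (c *: Q) p = c *: evalD Q p.
Proof.
pose k := maxn (msize (c *: Q)) (msize Q).
rewrite !(@evalD_wE k) ?leq_max ?leqnn ?orbT // scaler_sumr.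
by apply: eq_bigr => m _; rewrite mcoeffZ scalerA mulrA.
Qed.

Lemma evalD_X m p : evalD (mpolyX K m) p = u ^+ mdeg m *: p^`M[m].
Proof. by rewrite /evalD msuppX big_seq1 mcoeffX eqxx mul1r. Qed.

Lemma evalD_1 p : evalD 1 p = p.
Proof. by rewrite -mpolyX0 evalD_X mdeg0 scale1r mderivm0m. Qed.

Lemma evalD_0 p : evalD 0 p = 0.
Proof. by rewrite /evalD msupp0 big_nil. Qed.

Lemma evalD_sum (I : Type) (r : seq I) (F : I -> {mpoly K[n]}) p :
  evalD (\sum_(i <- r) F i) p = \sum_(i <- r) evalD (F i) p.
Proof.
by elim/big_rec2: _ => [|i x y _ <-]; rewrite ?evalD_0 ?evalD_add.
Qed.

(** With linearity in Q, this makes Q |-> Q(uD) a morphism from polynomials to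
    operators; multiplying by one variable at a time avoids a ring structure
    on the operators. *)
Lemma evalD_mulX i Q p :
  evalD (mpolyX K (mnm1 i) * Q) p = u *: mderiv i (evalD Q p).
Proof.
elim/mpolyind: Q => [|c m Q _ _ IH].
  by rewrite mulr0 evalD_0 mderiv0 scaler0.
rewrite mulrDr !evalD_add IH mderivD scalerDr; congr (_ + _).
rewrite -scalerAr -mpolyXD !evalD_scale !evalD_X !mderivZ mdegD mdeg1 add1n exprS.
rewrite mderivmDm -mderivmDm addmC mderivmDm mderivmU1m.
by rewrite !scalerA; congr (_ *: _); rewrite mulrCA mulrA.
Qed.

Lemma mcoeff_evalD Q p g :
  (evalD Q p)@_g = \sum_(m <- msupp Q) Q@_m * u ^+ mdeg m *
      (p@_(mnm_add m g) *+ \prod_(i < n) ((mnm_add m g) i ^_ (m i))).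
Proof.
rewrite /evalD raddf_sum /=; apply: eq_bigr => m _.
by rewrite mcoeffZ mcoeff_mderivm.
Qed.

Variable a : 'I_n -> K.

(** The conjugate of uD_i by an exponential: see [pderiv_expmul]. *)
Definition shifted_deriv i p : {mpoly K[n]} := a i *: p + u *: mderiv i p.

Lemma evalD_shifted_deriv i k Q p :
  evalD ((mpolyX K (mnm1 i) + mpolyC n (a i)) ^+ k * Q) p =
  iter k (shifted_deriv i) (evalD Q p).
Proof.
elim: k => [|k IH] /=; first by rewrite expr0 mul1r.
by rewrite exprS -mulrA mulrDl evalD_add evalD_mulX mul_mpolyC evalD_scale IH addrC.
Qed.

(** Substituting a_i + uD_i for the variables of P amounts to translating P
    to a and substituting uD_i, because Q |-> Q(uD) is multiplicative. *)
Lemma evalD_translate P p :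
  evalD (translate a P) p = \sum_(m <- msupp P)
     P@_m *: foldr (fun j => iter (m j) (shifted_deriv j)) p (enum 'I_n).
Proof.
rewrite {1}[P]mpolyE /translate raddf_sum /= evalD_sum; apply: eq_bigr => m _.
rewrite comp_mpolyZ evalD_scale comp_mpolyX; congr (_ *: _).
rewrite -big_enum /=; elim: (enum _) => [|i s IH] /=.
  by rewrite big_nil evalD_1.
by rewrite big_cons tnth_mktuple evalD_shifted_deriv IH.
Qed.

End Operator.

(** * Calculus of complex-valued functions *)

Section Analysis.
Variable R : realType.

Definition is_deriveC (V : normedModType R) (x v : V) (f : V -> R[i]) (df : R[i]) :=
  is_derive x v (fun y => complex.Re (f y)) (complex.Re df) /\
  is_derive x v (fun y => complex.Im (f y)) (complex.Im df).

Definition continuousC (V : normedModType R) (f : V -> R[i]) :=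
  continuous (fun y => complex.Re (f y)) /\ continuous (fun y => complex.Im (f y)).

Section Rules.
Variable V : normedModType R.
Implicit Types (f g : V -> R[i]) (x v : V).

(** Along the line x + t v the outer and inner functions are functions of one
    real variable, so the one-dimensional chain rule applies. *)
Lemma is_derive_comp1 (h : R -> R) (f : V -> R) x v a b :
  is_derive (f x) 1 h a -> is_derive x v f b -> is_derive x v (h \o f) (a * b).
Proof.
have line (k : V -> R) d :
    is_derive x v k d <-> is_derive (0 : R) 1 (fun t : R => k (t *: v + x)) d.
  have E : 'D_v k x = 'D_1 (fun t : R => k (t *: v + x)) 0.
    rewrite /derive; set g1 := fun t => _; set g2 := fun t => _.
    suff -> : g1 = g2 by [].
    by apply/funext => t; rewrite /g1 /g2 /= addr0 scale0r add0r [_%:A]mulr1.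
  split=> -[Dk <-]; (apply: DeriveDef; last by rewrite E).
  - exact/(derivable1P k x v).
  - exact/(derivable1P k x v).
move=> Dh /(line f) Df; apply/line.
apply: (is_derive1_comp (f := h)) => //.
by rewrite scale0r add0r.
Qed.

Lemma is_deriveC_cst x v c : is_deriveC x v (fun=> c) 0.
Proof.
split; [exact: (is_derive_cst (complex.Re c))|exact: (is_derive_cst (complex.Im c))].
Qed.

Lemma ReD (z w : R[i]) : complex.Re (z + w) = complex.Re z + complex.Re w.
Proof. by case: z w => [a b] [c e]. Qed.

Lemma ImD (z w : R[i]) : complex.Im (z + w) = complex.Im z + complex.Im w.
Proof. by case: z w => [a b] [c e]. Qed.

Lemma ReM (z w : R[i]) : complex.Re (z * w) =
  complex.Re z * complex.Re w - complex.Im z * complex.Im w.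
Proof. by case: z w => [a b] [c e]. Qed.

Lemma ImM (z w : R[i]) : complex.Im (z * w) =
  complex.Re z * complex.Im w + complex.Im z * complex.Re w.
Proof. by case: z w => [a b] [c e]. Qed.

Lemma is_deriveCD x v f g df dg : is_deriveC x v f df -> is_deriveC x v g dg ->
  is_deriveC x v (fun y => f y + g y) (df + dg).
Proof.
move=> [f1 f2] [g1 g2]; rewrite /is_deriveC.
under [X in is_derive _ _ X (complex.Re _)]eq_fun do rewrite ReD.
under [X in is_derive _ _ X (complex.Im _)]eq_fun do rewrite ImD.
by rewrite ReD ImD; split; exact: is_deriveD.
Qed.

Lemma is_deriveCM x v f g df dg : is_deriveC x v f df -> is_deriveC x v g dg ->
  is_deriveC x v (fun y => f y * g y) (f x * dg + g x * df).
Proof.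
move=> [f1 f2] [g1 g2]; rewrite /is_deriveC.
under [X in is_derive _ _ X (complex.Re _)]eq_fun do rewrite ReM.
under [X in is_derive _ _ X (complex.Im _)]eq_fun do rewrite ImM.
split.
- apply: (is_derive_eq (is_deriveB (is_deriveM f1 g1) (is_deriveM f2 g2))).
  rewrite ReD !ReM /GRing.scale /=; ring.
- apply: (is_derive_eq (is_deriveD (is_deriveM f1 g2) (is_deriveM f2 g1))).
  rewrite ImD !ImM /GRing.scale /=; ring.
Qed.

Lemma is_deriveC_cexp x v f df :
  is_deriveC x v f df -> is_deriveC x v (fun y => cexp (f y)) (cexp (f x) * df).
Proof.
move=> [f1 f2].
have De := is_derive_comp1 (is_derive_expR _) f1.
have Dc := is_derive_comp1 (is_derive_cos _) f2.
have Ds := is_derive_comp1 (is_derive_sin _) f2.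
split.
- apply: (is_derive_eq (is_deriveM De Dc)).
  rewrite ReM /GRing.scale /=; ring.
- apply: (is_derive_eq (is_deriveM De Ds)).
  rewrite ImM /GRing.scale /=; ring.
Qed.

Lemma continuousC_cst c : continuousC (fun _ : V => c).
Proof.
split; first exact: (@cst_continuous V R (complex.Re c)).
exact: (@cst_continuous V R (complex.Im c)).
Qed.

Lemma continuousCD f g : continuousC f -> continuousC g ->
  continuousC (fun y => f y + g y).
Proof.
move=> [f1 f2] [g1 g2]; rewrite /continuousC.
rewrite (funext (fun y => ReD (f y) (g y))) (funext (fun y => ImD (f y) (g y))).
by split=> x; apply: cvgD; [exact: f1|exact: g1|exact: f2|exact: g2].
Qed.

Lemma continuousCM f g : continuousC f -> continuousC g ->
  continuousC (fun y => f y * g y).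
Proof.
move=> [f1 f2] [g1 g2]; rewrite /continuousC.
rewrite (funext (fun y => ReM (f y) (g y))) (funext (fun y => ImM (f y) (g y))).
split=> x.
- apply: cvgB; apply: cvgM; [exact: f1|exact: g1|exact: f2|exact: g2].
- apply: cvgD; apply: cvgM; [exact: f1|exact: g2|exact: f2|exact: g1].
Qed.

Lemma continuousC_cexp f : continuousC f -> continuousC (fun y => cexp (f y)).
Proof.
move=> [f1 f2].
have e x : {for x, continuous (fun y => expR (complex.Re (f y)))}.
  by apply: (continuous_comp (f1 x)); exact: continuous_expR.
split=> x; apply: cvgM; try exact: e.
- by apply: (continuous_comp (f2 x)); exact: continuous_cos.
- by apply: (continuous_comp (f2 x)); exact: continuous_sin.
Qed.

End Rules.

Lemma cexp_neq0 (z : R[i]) : cexp z != 0.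
Proof.
rewrite eq_complex /= !mulf_eq0 !(gt_eqF (expR_gt0 _)) /=.
apply/negP => /andP[/eqP c0 /eqP s0].
have := cos2Dsin2 (complex.Im z); rewrite c0 s0 !expr0n /= addr0 => /eqP.
by rewrite eq_sym oner_eq0.
Qed.

Variable d : nat.
Implicit Types (p : {mpoly R[i][d]}) (x : 'rV[R]_d).

Lemma is_derive_coord (i j : 'I_d) x :
  is_derive x ('e_j) (fun y : 'rV[R]_d => y ord0 i) ((j == i)%:R).
Proof.
have Did : derivable (@id 'rV[R]_d) x 'e_j by exact: derivable_id.
apply: DeriveDef; first exact: (derivable_mxP id x 'e_j).1.
have := derive_mx Did; rewrite derive_id => /matrixP/(_ ord0 i).
by rewrite !mxE eqxx /= eq_sym => <-.
Qed.

Lemma is_deriveC_coord (i j : 'I_d) x :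
  is_deriveC x 'e_j (fun y => cvec y i) ((j == i)%:R).
Proof.
split; rewrite /cvec /=.
- by apply: is_derive_eq (is_derive_coord i j x) _; case: (j == i).
- by apply: is_derive_eq (is_derive_cst _ _ _) _; case: (j == i).
Qed.

Lemma continuousC_coord (i : 'I_d) : continuousC (fun y : 'rV[R]_d => cvec y i).
Proof.
split; first exact: (@coord_continuous R 1 d ord0 i).
exact: (@cst_continuous _ R 0).
Qed.

End Analysis.

(** * Exponential times polynomial *)

Section ExpPoly.
Variables (R : realType) (d : nat) (x0 : 'rV[R[i]]_d).
Implicit Types (p q P : {mpoly R[i][d]}) (x : 'rV[R]_d) (f : 'rV[R]_d -> R[i]).

Definition expmul p : 'rV[R]_d -> R[i] :=
  fun x => cexp ('i%C * cdot x0 x) * p.@[cvec x].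

Lemma is_deriveC_meval (j : 'I_d) x p :
  is_deriveC x 'e_j (fun y => p.@[cvec y]) (mderiv j p).@[cvec x].
Proof.
elim/mpoly_ring_ind: p => [c|i|p q Hp Hq|p q Hp Hq].
- rewrite mderivC meval0; under eq_fun do rewrite mevalC.
  exact: is_deriveC_cst.
- rewrite mderiv_var mevalC eq_sym; under eq_fun do rewrite mevalXU.
  exact: is_deriveC_coord.
- rewrite mderivD mevalD; under eq_fun do rewrite mevalD.
  exact: is_deriveCD.
- rewrite mderivM mevalD !mevalM; under eq_fun do rewrite mevalM.
  by have := is_deriveCM Hp Hq; congr is_deriveC; ring.
Qed.

Lemma continuousC_meval p : continuousC (fun x => p.@[cvec x]).
Proof.
elim/mpoly_ring_ind: p => [c|i|p q Hp Hq|p q Hp Hq].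
- under eq_fun do rewrite mevalC; exact: continuousC_cst.
- under eq_fun do rewrite mevalXU; exact: continuousC_coord.
- under eq_fun do rewrite mevalD; exact: continuousCD.
- under eq_fun do rewrite mevalM; exact: continuousCM.
Qed.

Lemma cdot_meval x :
  cdot x0 x = (\sum_(i < d) x0 ord0 i *: mpolyX R[i] (mnm1 i)).@[cvec x].
Proof.
by rewrite raddf_sum; apply: eq_bigr => i _; rewrite [RHS]mevalZ mevalXU.
Qed.

Lemma is_deriveC_cdot (j : 'I_d) x : is_deriveC x 'e_j (cdot x0) (x0 ord0 j).
Proof.
have := is_deriveC_meval j x (\sum_(i < d) x0 ord0 i *: mpolyX R[i] (mnm1 i)).
under eq_fun do rewrite -cdot_meval.
congr is_deriveC; rewrite (raddf_sum (mderiv j)) (raddf_sum (meval _)) /=.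
rewrite (bigD1 j) //= big1 => [|i /negbTE ij].
  by rewrite addr0 mderivZ mevalZ mderiv_var eqxx mevalC mulr1.
by rewrite mderivZ mevalZ mderiv_var ij mevalC mulr0.
Qed.

Lemma is_deriveC_expmul (j : 'I_d) x p :
  is_deriveC x 'e_j (expmul p)
    (expmul (('i%C * x0 ord0 j) *: p + mderiv j p) x).
Proof.
rewrite /expmul.
have := is_deriveCM (is_deriveC_cexp (is_deriveCM (is_deriveC_cst x 'e_j 'i%C)
  (is_deriveC_cdot j x))) (is_deriveC_meval j x p).
congr is_deriveC; rewrite mevalD mevalZ; ring.
Qed.

Lemma pderiv_expmul (j : 'I_d) p :
  pderiv j (expmul p) = expmul (('i%C * x0 ord0 j) *: p + mderiv j p).
Proof.
apply/funext => x; rewrite /pderiv.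
have [[_ ->] [_ ->]] := is_deriveC_expmul j x p.
by case: (expmul _ _).
Qed.

Lemma smooth_expmul p : smooth (expmul p).
Proof.
move=> s; have [q ->] : exists q, iter_pderiv s (expmul p) = expmul q.
  rewrite /iter_pderiv; elim: s => [|j s [q IH]] /=; first by exists p.
  by rewrite IH pderiv_expmul; eexists.
have [c1 c2] : continuousC (expmul q).
  apply: continuousCM (continuousC_meval q); apply: continuousC_cexp.
  apply: continuousCM; first exact: continuousC_cst.
  by rewrite (funext cdot_meval); exact: continuousC_meval.
split=> // j x.
by have [[? _] [? _]] := is_deriveC_expmul j x q.
Qed.

Lemma expmulD p q : expmul (p + q) = expmul p + expmul q.
Proof. by apply/funext => x; rewrite /expmul mevalD mulrDr. Qed.

Lemma expmulZ c p : expmul (c *: p) = c *: expmul p.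
Proof. by apply/funext => x; rewrite /expmul mevalZ mulrCA. Qed.

(** If the product is the zero function then so are its derivatives, hence,
    by [pderiv_expmul], the products of the exponential with the derivatives of
    p.  Their values at the origin are the coefficients of p, up to nonzero
    factors. *)
Lemma expmul_inj p : expmul p = 0 -> p = 0.
Proof.
move=> p0; have deriv0 q j : expmul q = 0 -> expmul (mderiv j q) = 0.
  move=> q0; have := pderiv_expmul j q.
  rewrite expmulD expmulZ q0 scaler0 add0r => <-.
  have -> : (0 : 'rV[R]_d -> R[i]) = expmul 0.
    by apply/funext => x; rewrite /expmul meval0 mulr0.
  by rewrite pderiv_expmul mderiv0 scaler0 addr0.
apply/mpolyP => m; rewrite mcoeff0; apply/eqP.
have /(congr1 (fun f => f 0)) : expmul (p^`M[m]) = 0.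
  by rewrite mderivm_foldr; elim: (flatten _) => //= i s; apply: deriv0.
rewrite /expmul => /eqP; rewrite mulf_eq0 (negbTE (cexp_neq0 _)) /=.
rewrite (_ : cvec 0 = fun=> 0); last by apply/funext => i; rewrite /cvec mxE.
rewrite -mcoeff0E mcoeff_mderivm mulrn_eq0 addm0 => /orP[|//].
rewrite -leqn0 leqNgt prodn_gt0 // => i.
by rewrite ffact_gt0.
Qed.

Lemma diffop_expmul P p :
  diffop P (expmul p) = expmul (evalD (- 'i%C) (translate (x0 ord0) P) p).
Proof.
have miDE j q : miD j (expmul q) = expmul (shifted_deriv (- 'i%C) (x0 ord0) j q).
  rewrite /miD pderiv_expmul /shifted_deriv; apply/funext => x.
  rewrite /expmul !mevalD !mevalZ.
  (* -i . i x0_j = x0_j: the shift by x0_j comes from the exponential *)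
  transitivity (- ('i%C * 'i%C) * (cexp ('i%C * cdot x0 x) *
      (x0 ord0 j * q.@[cvec x])) +
    cexp ('i%C * cdot x0 x) * (- 'i%C * (mderiv j q).@[cvec x])); first by ring.
  by rewrite -expr2 sqr_i opprK mul1r -mulrDr.
apply/funext => x; rewrite /diffop evalD_translate [RHS]/expmul raddf_sum /= mulr_sumr.
apply: eq_bigr => m _; rewrite mevalZ mulrCA; congr (_ * _).
rewrite /miDm -[RHS]/(expmul _ x); congr (_ x).
elim: (enum _) => //= j s ->; elim: (m j) => //= k ->.
by rewrite miDE.
Qed.

End ExpPoly.

(** * Counting and linear algebra *)

(** Forgetting the exponent of one variable is a bijection from the monomials
    of degree k in n + 1 variables to those of degree at most k in n
    variables; the former are counted by a binomial coefficient. *)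
Lemma card_bmultinom n k : #|{: bmultinom n k.+1}| = dtilde n k.
Proof.
have -> : dtilde n k = 'C(k + n, k).
  by rewrite /dtilde addnC -(bin_fact (leq_addr n k)) addKn mulnK // muln_gt0 !fact_gt0.
rewrite -(mpoly.size_basis n k).
(* [sb] lists the monomials of degree k in n + 1 variables; the map f drops the
   exponent of the first of them, and g puts it back. *)
set sb := [seq s2m (tval t) | t <- _].
pose f (m : multinom n.+1) : multinom n := Multinom [tuple m (lift ord0 i) | i < n].
have fE m i : f m i = m (lift ord0 i) by rewrite multinomE tnth_mktuple.
have fdeg m : mdeg m = (m ord0 + mdeg (f m))%N.
  rewrite !mdegE big_ord_recl; congr (_ + _)%N.
  by apply: eq_bigr => i _; rewrite fE.
have memsb m : (m \in sb) = (mdeg m == k) by rewrite -mpoly.basis_cover.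
rewrite cardE -(size_map val) -(size_map f sb).
apply/perm_size/uniq_perm.
- by rewrite map_inj_uniq ?enum_uniq //; exact: val_inj.
- rewrite map_inj_in_uniq ?mpoly.uniq_basis // => m m'.
  rewrite !memsb => /eqP mk /eqP m'k ff'.
  have e0 : m ord0 = m' ord0.
    by apply/eqP; rewrite -(eqn_add2r (mdeg (f m))) -fdeg ff' -fdeg mk m'k.
  apply/mnmP => i; case: (unliftP ord0 i) => [j ->|-> //].
  by rewrite -!fE ff'.
- move=> m; apply/mapP/mapP => -[].
  + move=> b _ ->.
    pose g : multinom n.+1 := Multinom [tuple
      if unlift ord0 i is Some j then val b j else (k - mdeg (val b))%N | i < n.+1].
    have gE i : g i = if unlift ord0 i is Some j then val b j else (k - mdeg (val b))%N.
      by rewrite multinomE tnth_mktuple.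
    have fg : f g = val b by apply/mnmP => i; rewrite fE gE liftK.
    exists g => //; rewrite memsb fdeg fg gE unlift_none subnK //.
    by rewrite -ltnS bmdeg.
  + move=> m'; rewrite memsb => /eqP m'k ->.
    have lt : (mdeg (f m') < k.+1)%N by rewrite ltnS -m'k fdeg leq_addl.
    by exists (BMultinom lt) => //; rewrite mem_enum.
Qed.

(** Rank-nullity for a surjective map that is given by a matrix, carried along
    an injective linear map: the images of the rows of a basis of the kernel
    form the basis that is asked for. *)
Lemma has_dim_kernel (K : fieldType) (V : lmodType K) (N M : nat)
    (A : 'M[K]_(N, M)) (phi : 'rV[K]_N -> V) :
  (forall c u v, phi (c *: u + v) = c *: phi u + phi v) ->
  (forall v, phi v = 0 -> v = 0) -> row_full A ->
  has_dim [set f | exists2 v, v *m A = 0 & f = phi v] (N - M).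
Proof.
move=> phiP phi_inj /eqP rA.
have rk : (\rank (kermx A) = N - M)%N by rewrite mxrank_ker rA.
rewrite -rk; set B := row_base (kermx A).
have phi0 : phi 0 = 0.
  have := phiP (-1) 0 0; rewrite scaler0 addr0 => ->.
  by rewrite scaleN1r addNr.
have phi_sum n (c : 'I_n -> K) (w : 'I_n -> 'rV_N) :
    \sum_i c i *: phi (w i) = phi (\sum_i c i *: w i).
  elim/big_rec2: _ => [|i x y _ ->]; first by rewrite phi0.
  by rewrite phiP.
have phiB (c : 'I_(\rank (kermx A)) -> K) :
    \sum_i c i *: phi (row i B) = phi ((\row_i c i) *m B).
  by rewrite phi_sum mulmx_sum_row; congr phi; apply: eq_bigr => i _; rewrite mxE.
exists (fun i => phi (row i B)); split.
  move=> c; rewrite phiB => /phi_inj cB i.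
  have : (\row_i c i) = 0.
    apply: (row_free_inj (row_base_free (kermx A))).
    by rewrite cB mul0mx.
  by move=> /rowP/(_ i); rewrite !mxE.
apply/seteqP; split=> f /=.
- move=> [v /sub_kermxP vA ->].
  have : (v <= B)%MS by rewrite eq_row_base.
  move=> /submxP[c ->]; exists (fun i => c ord0 i); rewrite phiB.
  by congr (phi (_ *m _)); apply/rowP => i; rewrite mxE.
- move=> [c ->]; rewrite phiB; eexists; last by [].
  apply/sub_kermxP; rewrite (submx_trans (submxMl _ _)) //.
  by rewrite eq_row_base.
Qed.

(** * The operator on polynomials of bounded degree *)

Lemma exists_min_msupp n (K : nzRingType) (Q : {mpoly K[n]}) : Q != 0 ->
  exists2 mu, Q@_mu != 0 & forall m, (m < mu)%O -> Q@_m = 0.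
Proof.
move=> Q0; have [a Qa] : exists a, Q@_a != 0.
  apply: contrapT => H; case/eqP: Q0; apply/mpolyP => m; rewrite mcoeff0.
  by apply: contrapT => Qm; apply: H; exists m; apply/eqP.
elim/(@ltmwf n): a Qa => a IH Qa.
have [[m [ma Qm]]|H] := pselect (exists m, (m < a)%O /\ Q@_m != 0).
  exact: IH Qm.
exists a => // m ma; apply: contrapT => /eqP Qm; apply: H.
by exists m.
Qed.

(** Row vectors indexed by the monomials of degree < k stand for the
    polynomials with terms of degree < k. *)
Section RowPoly.
Variables (n : nat) (K : fieldType).

Definition mon k (i : 'I_#|{: bmultinom n k}|) : multinom n := bmnm (enum_val i).

Lemma mon_deg k i : (mdeg (@mon k i) < k)%N.
Proof. exact: bmdeg. Qed.

Lemma mon_inj k : injective (@mon k).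
Proof. by move=> i j /val_inj/enum_val_inj. Qed.

Lemma mon_onto k m : (mdeg m < k)%N -> exists i, @mon k i = m.
Proof.
move=> mk; exists (enum_rank (BMultinom mk)).
by rewrite /mon enum_rankK.
Qed.

Definition rowpoly k (v : 'rV[K]_#|{: bmultinom n k}|) : {mpoly K[n]} :=
  \sum_i v ord0 i *: mpolyX K (mon i).

Lemma mcoeff_rowpoly k (v : 'rV[K]_#|{: bmultinom n k}|) i :
  (rowpoly v)@_(mon i) = v ord0 i.
Proof.
rewrite /rowpoly raddf_sum (bigD1 i) //= big1 => [|j ji].
  by rewrite mcoeffZ mcoeffX eqxx mulr1 addr0.
by rewrite mcoeffZ mcoeffX (inj_eq (@mon_inj k)) (negbTE ji) mulr0.
Qed.

Lemma mcoeff_rowpoly_ge k (v : 'rV[K]_#|{: bmultinom n k}|) m :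
  (k <= mdeg m)%N -> (rowpoly v)@_m = 0.
Proof.
move=> km; rewrite /rowpoly raddf_sum big1 // => i _ /=.
rewrite mcoeffZ mcoeffX; case: eqP => [im|_]; last by rewrite mulr0.
by move: km; rewrite leqNgt -im mon_deg.
Qed.

Lemma rowpoly_coeffs k (p : {mpoly K[n]}) :
  (forall m, (k <= mdeg m)%N -> p@_m = 0) ->
  p = rowpoly (\row_i p@_(@mon k i)).
Proof.
move=> pk; apply/mpolyP => m; have [km|mk] := leqP k (mdeg m).
  by rewrite mcoeff_rowpoly_ge // pk.
by have [i <-] := mon_onto mk; rewrite mcoeff_rowpoly mxE.
Qed.

Lemma rowpolyP k c (v w : 'rV[K]_#|{: bmultinom n k}|) :
  rowpoly (c *: v + w) = c *: rowpoly v + rowpoly w.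
Proof.
rewrite /rowpoly scaler_sumr -big_split; apply: eq_bigr => i _ /=.
by rewrite !mxE scalerDl scalerA.
Qed.

Lemma rowpoly_eq0 k (v : 'rV[K]_#|{: bmultinom n k}|) : rowpoly v = 0 -> v = 0.
Proof.
by move=> v0; apply/rowP => i; rewrite -mcoeff_rowpoly v0 mcoeff0 mxE.
Qed.

End RowPoly.

Section OperatorMatrix.
Variables (n : nat) (K : numFieldType) (u : K) (Q : {mpoly K[n]}) (e : nat).
Hypothesis u_neq0 : u != 0.
Hypothesis Q_order : forall m, (mdeg m < e)%N -> Q@_m = 0.

(** Every term of Q has degree at least e, hence differentiates at least e
    times. *)
Lemma mcoeff_evalD_ge N (p : {mpoly K[n]}) g :
  (forall m, (N <= mdeg m)%N -> p@_m = 0) -> (N - e <= mdeg g)%N ->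
  (evalD u Q p)@_g = 0.
Proof.
move=> pN Ng; rewrite mcoeff_evalD big1 // => m _.
have [me|em] := ltnP (mdeg m) e; first by rewrite Q_order // !mul0r.
by rewrite pN ?mul0rn ?mulr0 // mdegD -leq_subLR (leq_trans _ Ng) // leq_sub2l.
Qed.

(** The truncation of N - e is intended: if N < e, all polynomials of degree
    < N are mapped to zero, and the target is the zero space. *)
Definition evalD_mx N : 'M[K]_(#|{: bmultinom n N}|, #|{: bmultinom n (N - e)}|) :=
  \matrix_(i, j) (evalD u Q (mpolyX K (mon i)))@_(mon j).

Lemma evalD_rowpoly N (v : 'rV[K]_#|{: bmultinom n N}|) :
  evalD u Q (rowpoly v) = rowpoly (v *m evalD_mx N).
Proof.
rewrite [LHS](@rowpoly_coeffs _ _ (N - e)); last first.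
  by move=> m; apply: mcoeff_evalD_ge => g; apply: mcoeff_rowpoly_ge.
congr rowpoly; apply/rowP => j; rewrite !mxE {1}/rowpoly.
have evalD_lin (I : Type) (r : seq I) (c : I -> K) (F : I -> {mpoly K[n]}) :
    evalD u Q (\sum_(i <- r) c i *: F i) = \sum_(i <- r) c i *: evalD u Q (F i).
  rewrite /evalD; under [RHS]eq_bigr do rewrite scaler_sumr.
  rewrite exchange_big; apply: eq_bigr => m _ /=.
  rewrite (raddf_sum (mderivm m)) scaler_sumr; apply: eq_bigr => i _ /=.
  by rewrite mderivmZ !scalerA mulrC.
rewrite evalD_lin raddf_sum; apply: eq_bigr => i _ /=.
by rewrite mcoeffZ mxE.
Qed.

(** Surjectivity, as injectivity of the transpose.  Let mu be the lowest
    monomial of Q.  For a vector w in the kernel of the transpose, the equation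
    at the monomial mu + g involves w at g, with a nonzero factor (the lowest
    coefficient of Q, a power of u and falling factorials); at monomials above
    g, where the factor is a coefficient of Q below mu, hence zero; and at
    monomials below g, where w is zero by induction on g. *)
Lemma row_full_evalD_mx N (alpha : multinom n) :
  mdeg alpha = e -> Q@_alpha != 0 -> row_full (evalD_mx N).
Proof.
move=> ae Qa.
have [mu Qmu mu_min] : exists2 mu, Q@_mu != 0 & forall m, (m < mu)%O -> Q@_m = 0.
  by apply: exists_min_msupp; apply: contra Qa => /eqP ->; rewrite mcoeff0.
have mue : (mdeg mu <= e)%N.
  rewrite -ae; apply: lemc_mdeg; rewrite leNgt.
  by apply: contra Qa => /mu_min ->.
rewrite /row_full -mxrank_tr -/(row_free _); apply: inj_row_free => w wA.
suff w0 g j : mon j = g -> w ord0 j = 0.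
  by apply/rowP => j; rewrite (w0 _ _ (erefl _)) mxE.
elim/(@ltmwf n): g j => g IH j jg.
have lt_beta : (mdeg (mnm_add mu g) < N)%N.
  by rewrite mdegD -jg -ltn_subRL (leq_trans (mon_deg j)) // leq_sub2l.
have [i iE] := mon_onto lt_beta.
have /rowP/(_ i) := wA; rewrite !mxE (bigD1 j) //= big1 => [|k kj]; last first.
  rewrite !mxE; have [kg|gk|kg] := ltgtP (mon k) g.
  - by rewrite (IH _ kg) // mul0r.
  - rewrite mcoeff_evalD big1 ?mulr0 // => m _; rewrite mcoeffX iE.
    case: eqP => [mE|_]; last by rewrite mul0rn mulr0.
    rewrite mu_min ?mul0r // ltNge; apply/negP => mum.
    by have := lemc_lt_add mum gk; rewrite mE ltxx.
  - by case/eqP: kj; apply: (@mon_inj n (N - e)); rewrite kg.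
rewrite addr0 !mxE mcoeff_evalD iE jg (bigD1_seq mu) ?msupp_uniq ?mcoeff_msupp //=.
rewrite [X in _ * (_ + X)]big1 ?addr0 => [|m mmu]; last first.
  rewrite mcoeffX; case: eqP => [|_]; last by rewrite mul0rn mulr0.
  by move=> /esym/addIm /eqP; rewrite (negbTE mmu).
rewrite mcoeffX eqxx => /eqP; rewrite mulf_eq0 => /orP[/eqP //|].
rewrite !mulf_eq0 (negbTE Qmu) expf_eq0 (negbTE u_neq0) andbF /= pnatr_eq0.
rewrite -leqn0 leqNgt prodn_gt0 // => k.
by rewrite ffact_gt0 mnmDE leq_addr.
Qed.

End OperatorMatrix.

(** * The dimension of the kernel *)

Theorem theorem4p4 (R : realType) (d l : nat) (P : {mpoly R[i][d]})
    (x0 : 'rV[R[i]]_d) (alpha : multinom d)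
    (x0_root : P.@[x0 ord0] = 0)
    (alpha_neq0 : P^`M[alpha].@[x0 ord0] <> 0)
    (alpha_least : forall alpha' : multinom d,
      (mdeg alpha' < mdeg alpha)%N -> P^`M[alpha'].@[x0 ord0] = 0) :
  [/\ (0 < mdeg alpha <= l)%N ->
        has_dim (exp_poly x0 l `&` ker_diffop P)
          (dtilde d l - dtilde d (l - mdeg alpha))%N,
      (l < mdeg alpha)%N ->
        has_dim (exp_poly x0 l `&` ker_diffop P) (dtilde d l) &
      (l < mdeg alpha)%N ->
        exp_poly x0 l `&` ker_diffop P = exp_poly x0 l].
Proof.
set e := mdeg alpha in alpha_least *; pose Q := translate (x0 ord0) P.
have Q_order m : (mdeg m < e)%N -> Q@_m = 0.
  move=> /alpha_least; rewrite -mcoeff_translate => /eqP.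
  rewrite mulrn_eq0 => /orP[|/eqP //]; rewrite -leqn0 leqNgt prodn_gt0 // => i.
  exact: fact_gt0.
have Q_alpha : Q@_alpha != 0.
  by apply/eqP => Q0; apply: alpha_neq0; rewrite -mcoeff_translate -/Q Q0 mul0rn.
have u_neq0 : - 'i%C != 0 :> R[i] by rewrite oppr_eq0 eq_complex /= oner_eq0 andbF.
have exp_polyP f : exp_poly x0 l f <->
    exists v : 'rV[R[i]]_#|{: bmultinom d l.+1}|, f = expmul x0 (rowpoly v).
  split=> [[p pl ->]|[v ->]]; last first.
    exists (rowpoly v) => // m; rewrite mcoeff_msupp leqNgt; apply: contra => lm.
    by rewrite mcoeff_rowpoly_ge.
  exists (\row_i p@_(@mon d l.+1 i)); rewrite -rowpoly_coeffs // => m lm.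
  by apply/eqP; rewrite mcoeff_eq0; apply/negP => /pl; rewrite leqNgt lm.
pose A := evalD_mx (- 'i%C) Q e l.+1.
have kerP v : ker_diffop P (expmul x0 (rowpoly v)) <-> v *m A = 0.
  rewrite /ker_diffop /= diffop_expmul -/Q (evalD_rowpoly _ Q_order).
  split=> [[_ /funext H]|->].
    exact/rowpoly_eq0/(expmul_inj H).
  split; first exact: smooth_expmul.
  move=> x; rewrite /expmul /rowpoly big1 ?meval0 ?mulr0 // => i _.
  by rewrite mxE scale0r.
have capE : exp_poly x0 l `&` ker_diffop P =
    [set f | exists2 v, v *m A = 0 & f = expmul x0 (rowpoly v)].
  apply/seteqP; split=> f /=.
  - by move=> [/exp_polyP[v ->] /kerP vA]; exists v.
  - by move=> [v vA ->]; split; [apply/exp_polyP; exists v|apply/kerP].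
have dimE : has_dim (exp_poly x0 l `&` ker_diffop P)
    (dtilde d l - #|{: bmultinom d (l.+1 - e)}|)%N.
  rewrite capE -card_bmultinom; apply: has_dim_kernel.
  - by move=> c v w; rewrite rowpolyP expmulD expmulZ.
  - by move=> v /expmul_inj/rowpoly_eq0.
  - exact: (row_full_evalD_mx u_neq0).
have A0 : (l < e)%N -> #|{: bmultinom d (l.+1 - e)}| = 0%N.
  by move=> le; apply: eq_card0 => -[m]; have := le; rewrite -subn_eq0 => /eqP ->.
split.
- by move=> /andP[_ el]; rewrite -(card_bmultinom d (l - e)) -subSn.
- by move=> /A0 c0; rewrite c0 subn0 in dimE.
- move=> le; apply/seteqP; split=> f; first by case.
  move=> fl; split=> //; have /exp_polyP[v ->] := fl; apply/kerP.
  by apply/matrixP => i [j j_lt]; exfalso; move: j_lt; rewrite A0.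
Qed.
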